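(* Let $C_1,\dots,C_T\in\mathbb{R}^{n\times n}$ be symmetric with $0\preceq C_t\preceq I$, $T\ge1$, and let $\mathcal{B}^n_1$ be the probability simplex in $\mathbb{R}^n$. Start from $y_1\in\mathcal{B}^n_1$ and for $t=1,\dots,T$, incur the loss $y_t^\top C_ty_t$ and update $$v_{t+1,i}=\frac{y_{t,i}\exp(-\eta(C_ty_t)_i)}{\sum_jy_{t,j}\exp(-\eta(C_ty_t)_j)},\qquad y_{t+1,i}=\frac\alpha n+(1-\alpha)v_{t+1,i}.$$ Suppose $L>0$ satisfies $\min_{u\in\mathcal{B}^n_1}\sum_{t=r}^su^\top C_tu\le L$ for all $1\le r\le s\le T$, and set $\alpha=\frac1{T+1}$, $c=\frac{\sqrt{2\ln((1+T)n)+2}}{\sqrt L}$, $b=\frac c2$, $a=\frac b{2b+1}$, $\eta=2a$. Then $$\max_{[r,s]\subset[1,T]}\Big\{\sum_{t=r}^sy_t^\top C_ty_t-\min_{u\in\mathcal{B}^n_1}\sum_{t=r}^su^\top C_tu\Big\}\le2\sqrt{2L\big(\ln((1+T)n)+1\big)}+2\ln((1+T)n).$$ *)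

(* Defs.v *)
From HB Require Import structures.
From mathcomp Require Import all_boot all_order all_algebra.
From mathcomp Require Import all_classical all_reals all_analysis.
Set Implicit Arguments. Unset Strict Implicit. Unset Printing Implicit Defensive.
Import Order.TTheory GRing.Theory Num.Theory.
Local Open Scope classical_set_scope.
Local Open Scope ring_scope.

Section Defs.
Variables (R : realType) (n : nat).

Definition quad (A : 'M[R]_n) (u : 'cV[R]_n) : R := (u^T *m A *m u) 0 0.

Definition psd (A : 'M[R]_n) : Prop := forall x : 'cV[R]_n, 0 <= quad A x.

Definition simplex : set 'cV[R]_n :=
  [set u | (forall i, 0 <= u i 0) /\ \sum_i u i 0 = 1].

Definition minloss (C : nat -> 'M[R]_n) (r s : nat) : R :=
  inf [set (\sum_(r <= t < s.+1) quad (C t) u) | u in simplex].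

Definition update (eta alpha : R) (Ct : 'M[R]_n) (y : 'cV[R]_n) : 'cV[R]_n :=
  let g := Ct *m y in
  let Z := \sum_j y j 0 * expR (- eta * g j 0) in
  \col_i (alpha / n%:R + (1 - alpha) * (y i 0 * expR (- eta * g i 0) / Z)).

(* yfrom y1 k = y_{k+1} *)
Fixpoint yfrom (eta alpha : R) (C : nat -> 'M[R]_n) (y1 : 'cV[R]_n) (k : nat)
  : 'cV[R]_n :=
  match k with
  | 0 => y1
  | k'.+1 => update eta alpha (C k'.+1) (yfrom eta alpha C y1 k')
  end.

(* the iterate y_t, for t >= 1 *)
Definition yseq eta alpha C y1 (t : nat) : 'cV[R]_n := yfrom eta alpha C y1 t.-1.

End Defs.

(* Main.v *)
Require Import Defs.
From HB Require Import structures.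
From mathcomp Require Import all_boot all_order all_algebra.
From mathcomp Require Import all_classical all_reals all_analysis.
From mathcomp Require Import ring lra zify.
Set Implicit Arguments. Unset Strict Implicit. Unset Printing Implicit Defensive.
Import Order.TTheory GRing.Theory Num.Theory.
Import numFieldNormedType.Exports.
Local Open Scope classical_set_scope.
Local Open Scope ring_scope.

(** For [u] in the simplex let [Phi_t = \sum_i u_i ln y_(t,i)]. The multiplicative
    step raises it by [- eta u^T C y - ln Z], where [Z] is the normalizer. The
    gradient [C y] oscillates by at most [sqrt (2 q)] with [q = y^T C y], so
    Hoeffding's lemma gives [ln Z <= - eta q + eta^2 q / 4], while AM-GM gives
    [eta u^T C y <= b u^T C u + eta^2 q / (4 b)]; hence [gain * q - b u^T C u],
    with [gain = eta - eta^2 / 4 - eta^2 / (4 b)], is at most the increase of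
    [Phi]. This [gain] exceeds the value [a] obtained
    from the cruder oscillation bound [2 sqrt q]. The surplus absorbs the
    mixing with the uniform distribution, at most [(n - 1) / (n T + 1)] per
    round, and the first round, where [y1] may have zero entries and
    [Phi_1 = - oo]. Mixing also yields [Phi_t >= - ln ((1 + T) n)] for
    [t >= 2], and [Phi] telescopes over the window. With [2 b^2 L = M + 1],
    [M = ln ((1 + T) n)], the bound follows once [2 M] is at least
    [3 + 4 (T - 2) (n - 1) / (n T + 1)], which holds for [n, T >= 2]; the cases
    [n = 1] and [T = 1] are immediate. *)

(** * Hoeffding's lemma for a finite distribution *)

Lemma ge_at0_of_derive (R : realType) (f f' : R -> R) (x : R) :
  (forall t : R, is_derive t 1 f (f' t)) -> (forall t, 0 <= t -> 0 <= f' t) ->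
  0 <= x -> f 0 <= f x.
Proof.
move=> df f'_ge0 x_ge0.
have [|t /itvP t0x fE] := @MVT_segment R f f' 0 x x_ge0 (fun t _ => df t).
  by apply: derivable_within_continuous => t _; exact: (@ex_derive _ _ _ _ _ _ _ (df t)).
by rewrite -subr_ge0 fE subr0 mulr_ge0// f'_ge0// t0x.
Qed.

(** The left side [h] is the moment generating function of a sign with mean [m]. As [h'' = h], the
    second derivative of [ln h] is [1 - (h' / h) ^+ 2 <= 1]; integrating this twice from 0 gives the
    bound. *)
Lemma two_point_mgf (R : realType) (m x : R) : -1 <= m <= 1 -> 0 <= x ->
  (1 + m) / 2 * expR x + (1 - m) / 2 * expR (- x)
  <= expR (m * x + x ^+ 2 / 2).
Proof.
move=> /andP[m_ge m_le] x_ge0.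
pose h (t : R) := (1 + m) / 2 * expR t + (1 - m) / 2 * expR (- t).
pose h' (t : R) := (1 + m) / 2 * expR t - (1 - m) / 2 * expR (- t).
have dh (t : R) : is_derive t 1 h (h' t).
  by rewrite /h /h'; apply: is_derive_eq; rewrite /GRing.scale/=; ring.
have dh' (t : R) : is_derive t 1 h' (h t).
  by rewrite /h /h'; apply: is_derive_eq; rewrite /GRing.scale/=; ring.
have h_gt0 t : 0 < h t.
  rewrite /h; have := expR_gt0 t; have := expR_gt0 (- t).
  set a := expR _; set b := expR _ => a0 b0; nra.
have h0 : h 0 = 1 by rewrite /h oppr0 expR0; field.
have h'0 : h' 0 = m by rewrite /h' oppr0 expR0; field.
rewrite -[leLHS]/(h x); clearbody h h'.
have slope t : 0 <= t -> h' t / h t <= m + t.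
  move=> t0; pose k s := m + s - h' s * (h s)^-1.
  rewrite -subr_ge0 (_ : _ - _ = k t)// -[leLHS](_ : k 0 = 0); last first.
    by rewrite /k h0 h'0; field.
  apply: (@ge_at0_of_derive _ k (fun s => (h' s / h s) ^+ 2)) => [s|s _|//].
    have hs : h s != 0 by rewrite gt_eqF.
    have dV := is_deriveV hs (dh s).
    apply: is_derive_eq; rewrite /GRing.scale/=.
    by field.
  by rewrite sqr_ge0.
rewrite -[h x]lnK ?posrE// ler_expR -subr_ge0.
pose F s := m * s + s ^+ 2 / 2 - ln (h s).
rewrite -[leLHS](_ : F 0 = 0); last first.
  by rewrite /F h0 ln1; field.
apply: (@ge_at0_of_derive _ F (fun s => m + s - h' s / h s)) => [s|s s0|//].
  have dl := is_derive1_ln (h_gt0 s).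
  have dlh := is_derive1_comp dl (dh s).
  apply: is_derive_eq; rewrite /GRing.scale/=.
  by field; rewrite gt_eqF.
by rewrite subr_ge0 slope.
Qed.

(** The tangent of [expR] at the mean [z] lies below [expR]; averaging it over [a] and [b] returns
    [expR z]. *)
Lemma expR_chord (R : realType) (p a b : R) : 0 <= p <= 1 ->
  expR (p * a + (1 - p) * b) <= p * expR a + (1 - p) * expR b.
Proof.
move=> /andP[p0 p1]; set z := p * a + _.
have tangent t : expR z * (1 + (t - z)) <= expR t.
  have -> : expR t = expR z * expR (t - z) by rewrite -expRD addrC subrK.
  by rewrite ler_pM2l ?expR_gt0// expR_ge1Dx.
have -> : expR z = p * (expR z * (1 + (a - z))) + (1 - p) * (expR z * (1 + (b - z))).
  by rewrite /z; ring.
by apply: lerD; apply: ler_wpM2l => //; lra.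
Qed.

(** Replacing the exponential by its chord over [[c - s, c + s]] moves all mass to the two endpoints
    without changing the mean, which reduces the claim to [two_point_mgf]. *)
Lemma hoeffding_mgf (R : realType) (I : finType) (y g : I -> R) (c s eta : R) :
  (forall i, 0 <= y i) -> \sum_i y i = 1 -> 0 <= eta -> 0 <= s ->
  (forall i, `|g i - c| <= s) ->
  \sum_i y i * expR (- eta * g i)
  <= expR (- eta * (\sum_i y i * g i) + eta ^+ 2 * s ^+ 2 / 2).
Proof.
move=> y0 y1 eta0; rewrite le_eqVlt => /predU1P[<-|s0] gc.
  have gE i : g i = c.
    by apply/eqP; rewrite -subr_eq0 -normr_le0 gc.
  under eq_bigr do rewrite gE.
  under [in leRHS]eq_bigr do rewrite gE.
  by rewrite -!mulr_suml y1 !mul1r expr0n/= mulr0 mul0r addr0.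
set m := \sum_i y i * g i.
have chord i : expR (- eta * g i) <= expR (- eta * c) *
    ((1 - (g i - c) / s) / 2 * expR (eta * s) +
     (1 + (g i - c) / s) / 2 * expR (- (eta * s))).
  have /andP[lo hi] : - s <= g i - c <= s by rewrite -ler_norml gc.
  have -> : - eta * g i = - eta * c + - eta * (g i - c) by ring.
  rewrite expRD ler_pM2l ?expR_gt0//.
  set p := (1 - _) / 2.
  have /(@expR_chord _ p (eta * s) (- (eta * s))) : 0 <= p <= 1.
    rewrite /p; have : -1 <= (g i - c) / s <= 1.
      by rewrite ler_pdivlMr// ler_pdivrMr// mulN1r mul1r lo hi.
    by move=> /andP[? ?]; apply/andP; split; lra.
  have -> : p * (eta * s) + (1 - p) * - (eta * s) = - eta * (g i - c).
    by rewrite /p; field; rewrite gt_eqF.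
  suff -> : 1 - p = (1 + (g i - c) / s) / 2 by [].
  by rewrite /p; field; rewrite gt_eqF.
have mE : \sum_i y i * (g i - c) = m - c.
  by under eq_bigr do rewrite mulrBr; rewrite sumrB -mulr_suml y1 mul1r.
have m_itv : -1 <= - ((m - c) / s) <= 1.
  rewrite -ler_norml normrN normrM normfV (gtr0_norm s0) ler_pdivrMr// mul1r -mE.
  apply: (le_trans (ler_norm_sum _ _ _)).
  rewrite -[leRHS]mul1r -y1 mulr_suml; apply: ler_sum => i _.
  by rewrite normrM (ger0_norm (y0 i)) ler_wpM2l.
apply: (@le_trans _ _ (expR (- eta * c) *
    ((1 - (m - c) / s) / 2 * expR (eta * s) +
     (1 + (m - c) / s) / 2 * expR (- (eta * s))))).
  have -> : expR (- eta * c) *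
    ((1 - (m - c) / s) / 2 * expR (eta * s) +
     (1 + (m - c) / s) / 2 * expR (- (eta * s))) =
   \sum_i y i * (expR (- eta * c) *
    ((1 - (g i - c) / s) / 2 * expR (eta * s) +
     (1 + (g i - c) / s) / 2 * expR (- (eta * s)))).
    rewrite -mE; set E := expR _; set E1 := expR _; set E2 := expR _.
    rewrite [RHS](eq_bigr (fun i => E * (E1 + E2) / 2 * y i +
       E * (E2 - E1) / 2 / s * (y i * (g i - c)))); last by move=> i _; ring.
    by rewrite big_split/= -!mulr_sumr y1; ring.
  by apply: ler_sum => i _; rewrite ler_wpM2l.
have -> : - eta * m + eta ^+ 2 * s ^+ 2 / 2 =
    - eta * c + (- ((m - c) / s) * (eta * s) + (eta * s) ^+ 2 / 2).
  by field; rewrite gt_eqF.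
rewrite expRD ler_pM2l ?expR_gt0//.
have := @two_point_mgf _ _ (eta * s) m_itv (mulr_ge0 eta0 (ltW s0)).
by rewrite opprK.
Qed.

(** * Symmetric positive semidefinite forms *)

Section Quad.
Variables (R : realType) (n : nat).
Implicit Types (A : 'M[R]_n) (u v : 'cV[R]_n).

Lemma quadE A u : quad A u = \sum_i u i 0 * (A *m u) i 0.
Proof. by rewrite /quad -mulmxA mxE; apply: eq_bigr => i _; rewrite mxE. Qed.

Lemma dot_symmx A u v : A^T = A ->
  \sum_i v i 0 * (A *m u) i 0 = \sum_i u i 0 * (A *m v) i 0.
Proof.
move=> symA.
have dotE (x z : 'cV[R]_n) : \sum_i x i 0 * (A *m z) i 0 = (x^T *m A *m z) 0 0.
  by rewrite -mulmxA [RHS]mxE; apply: eq_bigr => i _; rewrite [x^T _ _]mxE.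
rewrite !dotE; transitivity ((v^T *m A *m u)^T 0 0); first by rewrite [RHS]mxE.
by rewrite !trmx_mul trmxK symA mulmxA.
Qed.

Lemma quad_lincomb A (a b : R) u v : A^T = A ->
  quad A (a *: u - b *: v) = a ^+ 2 * quad A u
    - 2 * a * b * (\sum_i u i 0 * (A *m v) i 0) + b ^+ 2 * quad A v.
Proof.
move=> symA; rewrite !quadE mulmxBr -!scalemxAr.
have -> : \sum_i (a *: u - b *: v) i 0 * (a *: (A *m u) - b *: (A *m v)) i 0 =
  a ^+ 2 * (\sum_i u i 0 * (A *m u) i 0) - a * b * (\sum_i u i 0 * (A *m v) i 0)
  - a * b * (\sum_i v i 0 * (A *m u) i 0) + b ^+ 2 * (\sum_i v i 0 * (A *m v) i 0).
  rewrite !mulr_sumr -!sumrB -big_split/=; apply: eq_bigr => i _.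
  by rewrite !mxE; ring.
by rewrite (dot_symmx u v)//; ring.
Qed.

Lemma psd_cauchy_schwarz A u v : A^T = A -> psd A ->
  (\sum_i u i 0 * (A *m v) i 0) ^+ 2 <= quad A u * quad A v.
Proof.
move=> symA psdA; set B := \sum_i _.
have q_ge0 := psdA v; have p_ge0 := psdA u.
have disc a b : 0 <= a ^+ 2 * quad A u - 2 * a * b * B + b ^+ 2 * quad A v.
  by rewrite -quad_lincomb.
move: q_ge0; rewrite le_eqVlt => /predU1P[q0|q_gt0].
  (* With [quad A v = 0], these coefficients turn [disc] into [0 <= - B ^+ 2 * (quad A u + 2)]. *)
  have := disc B (quad A u + 1); rewrite -q0 => H.
  suff : B ^+ 2 <= 0 by rewrite mulr0.
  have B2 := sqr_ge0 B; nra.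
have := disc (quad A v) B => H.
have {}H : 0 <= quad A v * (quad A u * quad A v - B ^+ 2).
  by apply: le_trans H _; rewrite le_eqVlt; apply/orP; left; apply/eqP; ring.
by rewrite pmulr_rge0// subr_ge0 in H.
Qed.

Lemma quad_id_sub A u : quad (1%:M - A) u = \sum_i u i 0 ^+ 2 - quad A u.
Proof.
rewrite !quadE mulmxBl mul1mx -sumrB; apply: eq_bigr => i _.
by rewrite mxE [X in _ + X]mxE mulrBr.
Qed.

End Quad.

(** Converts an oscillation bound into the centred form that [hoeffding_mgf] takes; the centre is
    the midpoint of the extreme values, which exist thanks to [i0]. *)
Lemma midrange (R : realType) (I : finType) (g : I -> R) (d : R) (i0 : I) :
  (forall i j, g i - g j <= d) -> exists c, forall i, `|g i - c| <= d / 2.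
Proof.
move=> gd.
case: (@arg_minP _ _ _ i0 predT g isT) => lo _ lo_min.
case: (@arg_maxP _ _ _ i0 predT g isT) => hi _ hi_max.
exists ((g lo + g hi) / 2) => i.
have := gd hi lo; have := lo_min i isT; have /= := hi_max i isT => ? ? ?.
by rewrite ler_norml; apply/andP; split; lra.
Qed.

(** * One round of the multiplicative update *)

Section Step.
Variables (R : realType) (n : nat).
Implicit Types (A : 'M[R]_n) (u v y : 'cV[R]_n).

Lemma simplex_dim_gt0 u : simplex u -> (0 < n)%N.
Proof.
by case: n u => [|//] u [_]; rewrite big_ord0 => /eqP; rewrite eq_sym oner_eq0.
Qed.

Lemma simplex_le1 u i : simplex u -> u i 0 <= 1.
Proof.
by move=> [u0 <-]; rewrite (bigD1 i)//= lerDl sumr_ge0.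
Qed.

Lemma simplex_quad_le1 A y : psd (1%:M - A) -> simplex y -> quad A y <= 1.
Proof.
move=> /(_ y); rewrite quad_id_sub subr_ge0 => qy ys.
apply: le_trans qy _; rewrite -ys.2; apply: ler_sum => i _.
by rewrite expr2 ler_piMl ?simplex_le1// ys.1.
Qed.

(* Cauchy-Schwarz against [e_i - e_j], whose squared length is 2: the gradient
   oscillates by at most [sqrt (2 q)], half of the [2 sqrt q] that bounding the
   entries separately would give. *)
Lemma psd_oscillation A y i j : A^T = A -> psd A -> psd (1%:M - A) ->
  (A *m y) i 0 - (A *m y) j 0 <= Num.sqrt (2 * quad A y).
Proof.
move=> symA psdA psdA'; pose e : 'cV[R]_n := delta_mx i 0 - delta_mx j 0.
have eE k : e k 0 = (k == i)%:R - (k == j)%:R by rewrite !mxE !eqxx !andbT.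
have pick k (f : 'I_n -> R) : \sum_l (l == k)%:R * f l = f k.
  rewrite (bigD1 k)//= eqxx mul1r big1 ?addr0// => l /negPf->.
  by rewrite mul0r.
have qe : quad A e <= 2.
  have := psdA' e; rewrite quad_id_sub subr_ge0 => /le_trans; apply.
  apply: (@le_trans _ _ (\sum_k ((k == i)%:R * 1 + (k == j)%:R * 1))).
    apply: ler_sum => k _; rewrite eE.
    by case: (k == i); case: (k == j) => /=; lra.
  by rewrite big_split/= !pick.
have := psd_cauchy_schwarz e y symA psdA.
have -> : \sum_k e k 0 * (A *m y) k 0 = (A *m y) i 0 - (A *m y) j 0.
  by under eq_bigr do rewrite eE mulrBl; rewrite sumrB !pick.
set x := _ - _ => x2.
apply: le_trans (ler_norm x) _; rewrite -sqrtr_sqr ler_wsqrtr//.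
by apply: le_trans x2 _; rewrite ler_wpM2r.
Qed.

(** The point $v_{t+1}$ before mixing, isolated so that progress and mixing cost can be estimated
    separately. *)
Definition expweights (eta : R) A y : 'cV[R]_n :=
  \col_i (y i 0 * expR (- eta * (A *m y) i 0) /
          \sum_j y j 0 * expR (- eta * (A *m y) j 0)).

Lemma weights_gt0 (f : 'I_n -> R) y :
  simplex y -> 0 < \sum_j y j 0 * expR (f j).
Proof.
move=> ys; have yf0 j : 0 <= y j 0 * expR (f j) by rewrite mulr_ge0 ?expR_ge0 ?ys.1.
rewrite lt0r sumr_ge0// andbT; apply/eqP => /psumr_eq0P H.
have : \sum_j y j 0 = 0.
  apply: big1 => j _; have /eqP := H (fun j _ => yf0 j) j isT.
  by rewrite mulf_eq0 expR_eq0 orbF => /eqP.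
by rewrite ys.2 => /eqP; rewrite oner_eq0.
Qed.

Lemma simplex_expweights eta A y : simplex y -> simplex (expweights eta A y).
Proof.
move=> ys; have Z0 := weights_gt0 (fun j => - eta * (A *m y) j 0) ys.
split=> [i|]; rewrite ?mxE.
  by rewrite mulr_ge0 ?invr_ge0 ?(ltW Z0)// mulr_ge0 ?expR_ge0// ys.1.
under eq_bigr do rewrite mxE.
by rewrite -mulr_suml divff// gt_eqF.
Qed.

Lemma expweights_gt0 eta A y : simplex y -> (forall i, 0 < y i 0) ->
  forall i, 0 < expweights eta A y i 0.
Proof.
move=> ys y0 i; rewrite mxE divr_gt0 ?mulr_gt0 ?expR_gt0//.
exact: (weights_gt0 (fun j => - eta * (A *m y) j 0) ys).
Qed.

Lemma expweights_progress eta b A u y : 0 <= eta -> 0 < b ->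
  A^T = A -> psd A -> psd (1%:M - A) ->
  simplex u -> simplex y -> (forall i, 0 < y i 0) ->
  (eta - eta ^+ 2 / 4 - eta ^+ 2 / (4 * b)) * quad A y
  <= b * quad A u + \sum_i u i 0 * ln (expweights eta A y i 0)
     - \sum_i u i 0 * ln (y i 0).
Proof.
move=> eta0 b0 symA psdA psdA' us ys y0.
set q := quad A y; have q0 : 0 <= q := psdA y.
set Z := \sum_j y j 0 * expR (- eta * (A *m y) j 0).
have Z0 : 0 < Z := weights_gt0 (fun j => - eta * (A *m y) j 0) ys.
have lnvE i : ln (expweights eta A y i 0) =
    ln (y i 0) - eta * (A *m y) i 0 - ln Z.
  rewrite mxE -/Z ln_div ?posrE// ?mulr_gt0 ?expR_gt0//.
  by rewrite lnM ?posrE ?expR_gt0// expRK mulNr.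
have -> : \sum_i u i 0 * ln (expweights eta A y i 0) =
    \sum_i u i 0 * ln (y i 0) - eta * (\sum_i u i 0 * (A *m y) i 0) - ln Z.
  rewrite -[ln Z]mul1r -us.2 mulr_sumr mulr_suml -!sumrB.
  by apply: eq_bigr => i _; rewrite lnvE; ring.
have lnZ : ln Z <= - eta * q + eta ^+ 2 * q / 4.
  have i0 := Ordinal (simplex_dim_gt0 ys).
  have [c gc] := @midrange _ _ (fun i => (A *m y) i 0) _ i0
    (fun i j => psd_oscillation y i j symA psdA psdA').
  (* The radius squared is [q / 2], so Hoeffding's variance term is [eta ^+ 2 * q / 4]. *)
  have s0 : 0 <= Num.sqrt (2 * q) / 2 by rewrite divr_ge0 ?sqrtr_ge0.
  have := hoeffding_mgf ys.1 ys.2 eta0 s0 gc.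
  rewrite -/Z -quadE -/q -[Z in Z <= _]lnK ?posrE// ler_expR => /le_trans; apply.
  by rewrite expr_div_n sqr_sqrtr ?mulr_ge0//; lra.
have cross : eta * (\sum_i u i 0 * (A *m y) i 0)
    <= b * quad A u + eta ^+ 2 * q / (4 * b).
  (* Nonnegativity of the form at this vector is the AM-GM inequality multiplied by [4 * b]. *)
  have := psdA (2 * b *: u - eta *: y); rewrite quad_lincomb// -/q.
  set B := \sum_i _ => H.
  rewrite -(@ler_pM2l _ (4 * b)) ?mulr_gt0//.
  rewrite [leRHS](_ : _ = 4 * b ^+ 2 * quad A u + eta ^+ 2 * q); first by lra.
  by field; rewrite gt_eqF.
have -> : (eta - eta ^+ 2 / 4 - eta ^+ 2 / (4 * b)) * q =
  eta * q - eta ^+ 2 * q / 4 - eta ^+ 2 * q / (4 * b) by ring.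
lra.
Qed.

End Step.

(** * The mixed iterates and the potential over a window *)

Section Run.
Variables (R : realType) (n : nat).
Implicit Types (A : 'M[R]_n) (u v y : 'cV[R]_n).

Lemma updateE (eta alpha : R) A y i : update eta alpha A y i 0 =
  alpha / n%:R + (1 - alpha) * expweights eta A y i 0.
Proof. by rewrite !mxE. Qed.

Lemma simplex_update (eta alpha : R) A y : 0 <= alpha <= 1 ->
  simplex y -> simplex (update eta alpha A y).
Proof.
move=> /andP[a0 a1] ys; have [v0 v1] := simplex_expweights eta A ys.
have n0 : (n%:R : R) != 0 by rewrite pnatr_eq0 -lt0n (simplex_dim_gt0 ys).
split=> [i|]; first by rewrite updateE addr_ge0 ?mulr_ge0 ?invr_ge0 ?subr_ge0.
under eq_bigr do rewrite updateE.
rewrite big_split/= sumr_const card_ord -mulr_sumr v1 -(mulr_natr (alpha / _)) mulfVK//.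
by rewrite mulr1 subrKC.
Qed.

Lemma update_ge (eta alpha : R) A y i : alpha <= 1 -> simplex y ->
  alpha / n%:R <= update eta alpha A y i 0.
Proof.
move=> a1 ys; have [v0 _] := simplex_expweights eta A ys.
by rewrite updateE lerDl mulr_ge0// subr_ge0.
Qed.

(* Since [v_i <= 1], the uniform share also satisfies [alpha / n >= (alpha / n) v_i]. *)
Lemma mixing_cost (eta alpha : R) A u y : 0 < alpha < 1 ->
  simplex u -> simplex y -> (forall i, 0 < y i 0) ->
  \sum_i u i 0 * ln (expweights eta A y i 0) + ln (1 - alpha + alpha / n%:R)
  <= \sum_i u i 0 * ln (update eta alpha A y i 0).
Proof.
move=> /andP[a0 a1] us ys y0; set w := 1 - alpha + _.
have vs := simplex_expweights eta A ys.
have an0 : 0 <= alpha / n%:R by rewrite divr_ge0// ltW.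
have w0 : 0 < w by rewrite ltr_wpDr// subr_gt0.
rewrite -[ln w]mul1r -us.2 mulr_suml -big_split/=.
apply: ler_sum => i _; rewrite -mulrDr; apply: ler_wpM2l; first exact: us.1.
have v0 := expweights_gt0 eta A ys y0 i.
have wv0 : 0 < expweights eta A y i 0 * w by rewrite mulr_gt0.
have le_upd : expweights eta A y i 0 * w <= update eta alpha A y i 0.
  have := ler_piMr an0 (simplex_le1 i vs).
  by rewrite updateE /w; lra.
by rewrite -lnM ?posrE// ler_ln ?posrE// (lt_le_trans wv0).
Qed.

Section Window.
Variables (T : nat) (C : nat -> 'M[R]_n) (y1 : 'cV[R]_n) (eta alpha b : R).
Hypothesis CP : forall t, (1 <= t <= T)%N ->
  (C t)^T = C t /\ psd (C t) /\ psd (1%:M - C t).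
Hypotheses (y1s : simplex y1) (alpha_itv : 0 < alpha < 1).
Hypotheses (eta_ge0 : 0 <= eta) (b_gt0 : 0 < b).

Local Notation y := (yseq eta alpha C y1).

Lemma yseqS t : (0 < t)%N -> y t.+1 = update eta alpha (C t) (y t).
Proof. by case: t. Qed.

Lemma simplex_yseq t : simplex (y t).
Proof.
have a01 : 0 <= alpha <= 1 by case/andP: alpha_itv => ? ?; rewrite !ltW.
rewrite /yseq; elim: t.-1 => [//|k IH] /=; exact: simplex_update.
Qed.

Lemma yseq_ge t i : (1 < t)%N -> alpha / n%:R <= y t i 0.
Proof.
case: t => [//|[//|t]] _; rewrite yseqS//.
by apply: update_ge; [case/andP: alpha_itv => _ /ltW|exact: simplex_yseq].
Qed.

Lemma uniform_share_gt0 : 0 < alpha / n%:R.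
Proof.
case/andP: alpha_itv => a0 _.
by rewrite divr_gt0// ltr0n (simplex_dim_gt0 y1s).
Qed.

Lemma yseq_gt0 t i : (1 < t)%N -> 0 < y t i 0.
Proof. by move=> t1; exact: lt_le_trans uniform_share_gt0 (yseq_ge i t1). Qed.

Local Notation gain := (eta - eta ^+ 2 / 4 - eta ^+ 2 / (4 * b)).

Lemma window_loss r k u : (1 < r)%N -> (r + k <= T)%N -> simplex u ->
  gain * (\sum_(r <= t < (r + k).+1) quad (C t) (y t))
  <= b * (\sum_(r <= t < (r + k).+1) quad (C t) u)
     + ln (n%:R / alpha) - k%:R * ln (1 - alpha + alpha / n%:R).
Proof.
move=> r1 rkT us; set d := ln (1 - _ + _).
(* The induction stops at the last potential before mixing, so [k + 1] rounds pay for only [k]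
   mixings; that potential is then dropped, being nonpositive. *)
suff potential :
  gain * (\sum_(r <= t < (r + k).+1) quad (C t) (y t))
  <= b * (\sum_(r <= t < (r + k).+1) quad (C t) u)
     + \sum_i u i 0 * ln (expweights eta (C (r + k)) (y (r + k)) i 0)
     + ln (n%:R / alpha) - k%:R * d.
  have vs := simplex_expweights eta (C (r + k)) (simplex_yseq (r + k)).
  have : \sum_i u i 0 * ln (expweights eta (C (r + k)) (y (r + k)) i 0) <= 0.
    apply: sumr_le0 => i _; apply: mulr_ge0_le0; first exact: us.1.
    by rewrite ln_le0// simplex_le1.
  lra.
have step t : (1 < t <= T)%N -> gain * quad (C t) (y t)
  <= b * quad (C t) u + \sum_i u i 0 * ln (expweights eta (C t) (y t) i 0)
     - \sum_i u i 0 * ln (y t i 0).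
  move=> /andP[t1 tT]; have [|symC [psdC psdC']] := CP (t := t).
    by rewrite tT ltnW.
  apply: expweights_progress => //; first exact: simplex_yseq.
  by move=> i; exact: yseq_gt0.
elim: k rkT => [|k IH] rkT.
  rewrite addn0 in rkT *; rewrite !big_nat1 mul0r subr0.
  have := step r; rewrite r1 rkT => /(_ isT).
  suff : - ln (n%:R / alpha) <= \sum_i u i 0 * ln (y r i 0) by lra.
  have -> : - ln (n%:R / alpha) = ln (alpha / n%:R).
    by rewrite -lnV ?invf_div// posrE -invr_gt0 invf_div uniform_share_gt0.
  rewrite -[leLHS]mul1r -{1}us.2 mulr_suml; apply: ler_sum => i _.
  apply: ler_wpM2l; first exact: us.1.
  rewrite ler_ln ?posrE ?uniform_share_gt0 ?yseq_gt0//; exact: yseq_ge.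
rewrite addnS in rkT *.
rewrite !(@big_nat_recr _ _ _ (r + k).+1)/= ?(leq_trans _ (leq_addr _ _))//; last first.
- by rewrite ltnW// ltnS leq_addr.
- by rewrite ltnW// ltnS leq_addr.
rewrite !mulrDr.
have {}IH := IH (ltnW rkT).
have := step (r + k).+1; rewrite rkT ltnS (leq_trans (ltnW r1) (leq_addr _ _)).
move=> /(_ isT).
have rk0 : (1 < r + k)%N by rewrite (leq_trans r1) ?leq_addr.
have := @mixing_cost eta alpha (C (r + k)) u (y (r + k)) alpha_itv us
  (simplex_yseq _) (fun i => yseq_gt0 i rk0).
rewrite -yseqS; last exact: ltnW.
rewrite -/d; have -> : k.+1%:R * d = k%:R * d + d by rewrite -natr1 mulrDl mul1r.
lra.
Qed.

End Window.
End Run.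

(** * Numerical estimates and the final arithmetic *)

Lemma ln_ge_tangent (R : realType) (k x : R) : 0 < x ->
  k + 1 - expR k / x <= ln x.
Proof.
move=> x0; have := expR_ge1Dx (k - ln x).
by rewrite expRB lnK ?posrE//; lra.
Qed.

(** The square and cube of this number are [exp (5 / 3)] and [exp (5 / 2)]. The bound comes from the
    tenth power of [exp (1 / 12) <= 12 / 11]. *)
Lemma expR_5_6 (R : realType) : expR (5 / 6 : R) <= 43 / 18.
Proof.
have x12 : expR (12^-1 : R) <= 12 / 11.
  have := expR_ge1Dx (- 12^-1 : R); rewrite expRN => H.
  rewrite -lef_pV2 ?posrE ?expR_gt0 ?divr_gt0//.
  by apply: le_trans H; lra.
have -> : (5 / 6 : R) = 10%:R * 12^-1 by lra.
rewrite expRM_natl; apply: (@le_trans _ _ ((12 / 11) ^+ 10)).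
  by rewrite lerXn2r ?nnegrE ?expR_ge0 ?divr_ge0.
by lra.
Qed.

(* With [N = (1 + T) n], the tangent of [ln] in the variable [1 / N] at
   [N = exp (5 / 2)] gives [ln N >= 7 / 2 - exp (5 / 2) / N], which is sharp
   enough except at [T = n = 2]; there [N = 6] and the tangent at [exp (5 / 3)]
   is used. *)
Lemma ln_budget (R : realType) (n T : nat) : (1 < n)%N -> (1 < T)%N ->
  3 + 4 * ((T%:R - 2) * ((n%:R - 1) / (n%:R * T%:R + 1)))
  <= 2 * ln ((1 + T)%:R * n%:R) :> R.
Proof.
move=> n1 T1; have e56 := expR_5_6 R; have e0 := expR_gt0 (5 / 6 : R).
have N0 : 0 < (1 + T)%:R * n%:R :> R by rewrite mulr_gt0 ?ltr0n// ltnW.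
case: (eqVneq (T + n.*2)%N 6%N) => Tn.
  have [-> ->] : T = 2%N /\ n = 2%N by lia.
  have := @ln_ge_tangent R (2%:R * (5 / 6)) 6%:R.
  have -> : (1 + 2)%:R * 2%:R = 6%:R :> R by rewrite -natrM.
  rewrite ltr0n expRM_natl => /(_ isT); set l := ln _ => lnl.
  rewrite subrr mul0r mulr0 addr0.
  have : expR (5 / 6 : R) ^+ 2 <= 6 by nra.
  lra.
have := @ln_ge_tangent R (3%:R * (5 / 6)) _ N0; rewrite expRM_natl.
set l := ln _ => lnl.
have e52 : expR (5 / 6 : R) ^+ 3 <= 137 / 10.
  apply: (@le_trans _ _ ((43 / 18) ^+ 3)); last by lra.
  by rewrite lerXn2r ?nnegrE ?(ltW e0)// divr_ge0.
have t2 : 2 <= T%:R :> R by rewrite ler_nat.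
have m2 : 2 <= n%:R :> R by rewrite ler_nat.
have D0 : 0 < n%:R * T%:R + 1 :> R by nra.
set t : R := T%:R in t2 D0 *; set m : R := n%:R in m2 D0 *.
have NE : (1 + T)%:R * m = m * t + m by rewrite natrD mulrC mulrDr mulr1 addrC.
rewrite NE in lnl N0.
suff : expR (5 / 6) ^+ 3 / (m * t + m) <= 2 * (1 - (t - 2) * ((m - 1) / (m * t + 1))).
  lra.
have -> : 1 - (t - 2) * ((m - 1) / (m * t + 1)) = (2 * m + t - 1) / (m * t + 1).
  by field; rewrite gt_eqF.
rewrite ler_pdivrMr//.
rewrite [leRHS](_ : _ = 2 * (2 * m + t - 1) * (m * t + m) / (m * t + 1)); last by ring.
rewrite ler_pdivlMr//.
apply: (@le_trans _ _ (137 / 10 * (m * t + 1))).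
  by rewrite ler_wpM2r// ltW.
(* Once [t + 2 * m >= 8], the factor [2 * (2 * m + t - 1)] is at least 14, above [137 / 10]; the sum
   7 occurs only for [T = 3], [n = 2] and is computed. *)
have [/eqP Tn7|Tn7] := eqVneq (T + n.*2)%N 7%N.
  have [TE nE] : T = 3%N /\ n = 2%N by lia.
  by rewrite /t /m TE nE; lra.
have : 8 <= t + 2 * m.
  by rewrite /t /m -natrM -natrD ler_nat; lia.
nra.
Qed.

Lemma regret_arith (R : realType) (b L M delta Q S : R) :
  let eta := 2 * (b / (2 * b + 1)) in
  0 < b -> 0 <= delta -> 2 * b ^+ 2 * L = M + 1 -> 3 + 4 * delta <= 2 * M ->
  S <= L ->
  (eta - eta ^+ 2 / 4 - eta ^+ 2 / (4 * b)) * (Q - 1) <= b * S + M + delta ->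
  Q - S <= 4 * b * L + 2 * M.
Proof.
move=> eta b0 d0 LE Md SL.
have b1 : 0 < 2 * b + 1 by lra.
have -> : eta - eta ^+ 2 / 4 - eta ^+ 2 / (4 * b)
    = b * (3 * b + 1) / (2 * b + 1) ^+ 2.
  by rewrite /eta; field; rewrite !gt_eqF.
rewrite mulrAC ler_pdivrMr ?exprn_gt0// => H.
have A0 : 0 < b * (3 * b + 1) by rewrite mulr_gt0//; lra.
rewrite -(ler_pM2l A0).
(* Moving [S] to the left leaves [b * (2 * b + 1) ^+ 2 - b * (3 * b + 1) = b ^+ 2 * (4 * b + 1)] as
   its coefficient on the right. *)
have SL' : b ^+ 2 * (4 * b + 1) * S <= b ^+ 2 * (4 * b + 1) * L.
  by rewrite ler_wpM2l// mulr_ge0 ?sqr_ge0//; lra.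
(* With [L] eliminated, compare powers of [b]: the [b ^+ 2] coefficient of the difference is
   [2 * M - 3 - 4 * delta], whence the hypothesis on [M]. *)
have key : (4 * b + 1) * (M + 1) / 2 + (M + delta) * (2 * b + 1) ^+ 2
    + b * (3 * b + 1) <= 2 * (3 * b + 1) * (M + 1) + 2 * M * (b * (3 * b + 1)).
  have bb : 0 <= b ^+ 2 * (2 * M - 3 - 4 * delta).
    by rewrite mulr_ge0 ?sqr_ge0//; lra.
  have b' : 0 <= b * (2 * M + 3 - 4 * delta) by rewrite mulr_ge0 ?ltW//; lra.
  lra.
rewrite -LE in key; lra.
Qed.

(** * The comparator infimum, the mixing weight and the assembly *)

Lemma minloss_ge (R : realType) (n : nat) (C : nat -> 'M[R]_n) (r s : nat)
    (y : 'cV[R]_n) (x : R) : simplex y ->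
  (forall u, simplex u -> x <= \sum_(r <= t < s.+1) quad (C t) u) ->
  x <= minloss C r s.
Proof.
move=> ys xle; apply: lb_le_inf; first by eexists; exists y.
by move=> _ [u us <-]; exact: xle.
Qed.

Lemma simplex_dim1 (R : realType) (n : nat) (u v : 'cV[R]_n) :
  n = 1%N -> simplex u -> simplex v -> u = v.
Proof.
move=> n1; subst n => -[_ u1] [_ v1]; apply/colP => i; rewrite (ord1 i).
by move: u1 v1; rewrite !big_ord1 => -> ->.
Qed.

(** This is [- ln w <= 1 / w - 1], where [w] has reciprocal [(n T + n) / (n T + 1)]. *)
Lemma ln_mixing_weight_ge (R : realType) (n T : nat) : (0 < n)%N ->
  - ln (1 - 1 / T.+1%:R + 1 / T.+1%:R / n%:R)
  <= (n%:R - 1) / (n%:R * T%:R + 1) :> R.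
Proof.
move=> n0; set w := 1 - _ + _.
have m1 : 1 <= n%:R :> R by rewrite ler1n.
have t0 : 0 <= T%:R :> R by [].
have D0 : 0 < n%:R * T%:R + 1 :> R by rewrite ltr_wpDl// mulr_ge0.
have wE : w^-1 = (n%:R * T%:R + n%:R) / (n%:R * T%:R + 1).
  rewrite /w -natr1; field.
  by rewrite !lt0r_neq0// ?ltr_wpDl// (lt_le_trans ltr01).
have w0 : 0 < w.
  by rewrite -invr_gt0 wE divr_gt0// ltr_wpDl ?mulr_ge0// (lt_le_trans ltr01).
have := @ln_ge_tangent R 0 w w0; rewrite expR0 mul1r wE add0r.
have -> : (n%:R - 1) / (n%:R * T%:R + 1) =
  (n%:R * T%:R + n%:R) / (n%:R * T%:R + 1) - 1 :> R by field; rewrite gt_eqF.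
lra.
Qed.

Theorem theorem4p6 (R : realType) (n T : nat) (C : nat -> 'M[R]_n)
    (y1 : 'cV[R]_n) (L : R) :
  (1 <= T)%N ->
  (forall t, (1 <= t <= T)%N ->
     (C t)^T = C t /\ psd (C t) /\ psd (1%:M - C t)) ->
  simplex y1 ->
  0 < L ->
  (forall r s, (1 <= r)%N -> (r <= s)%N -> (s <= T)%N -> minloss C r s <= L) ->
  let alpha : R := 1 / (T.+1)%:R in
  let c : R := Num.sqrt (2 * ln ((1 + T)%:R * n%:R) + 2) / Num.sqrt L in
  let b : R := c / 2 in
  let a : R := b / (2 * b + 1) in
  let eta : R := 2 * a in
  forall r s, (1 <= r)%N -> (r <= s)%N -> (s <= T)%N ->
    \sum_(r <= t < s.+1) quad (C t) (yseq eta alpha C y1 t) - minloss C r s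
    <= 2 * Num.sqrt (2 * L * (ln ((1 + T)%:R * n%:R) + 1))
       + 2 * ln ((1 + T)%:R * n%:R).
Proof.
move=> T1 CP y1s L0 minL alpha c b a eta r s r1 rs sT.
have n0 := simplex_dim_gt0 y1s.
set M := ln _ in c b a eta *.
have N1 : 1 <= (1 + T)%:R * n%:R :> R by rewrite -natrM ler1n muln_gt0.
have N0 : 0 < (1 + T)%:R * n%:R :> R := lt_le_trans ltr01 N1.
have M0 : 0 <= M by rewrite /M ln_ge0.
have alpha_itv : 0 < alpha < 1.
  rewrite /alpha divr_gt0 ?ltr0n//= ltr_pdivrMr ?ltr0n//.
  by rewrite mul1r ltr1n.
have c0 : 0 < c by rewrite /c divr_gt0// sqrtr_gt0//; lra.
have b0 : 0 < b by rewrite /b divr_gt0.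
have eta0 : 0 <= eta.
  by rewrite /eta /a mulr_ge0// divr_ge0 ?ltW//; lra.
have b2L : 2 * b ^+ 2 * L = M + 1.
  rewrite /b /c !expr_div_n !sqr_sqrtr ?(ltW L0)//; last by lra.
  by field; rewrite gt_eqF.
clearbody b.
(* The choice of [b] makes the radicand a perfect square, so the target is [4 * b * L + 2 * M]. *)
have -> : Num.sqrt (2 * L * (M + 1)) = 2 * b * L.
  have -> : 2 * L * (M + 1) = (2 * b * L) ^+ 2 by rewrite -b2L; ring.
  by rewrite sqrtr_sqr ger0_norm// !mulr_ge0 ?ltW.
have ys t : simplex (yseq eta alpha C y1 t) by exact: simplex_yseq.
set y := yseq eta alpha C y1 in ys *.
have q_ge0 t u : (1 <= t <= T)%N -> 0 <= quad (C t) u.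
  by move=> /CP[_ [+ _]]; apply.
have sum_ge0 m k u : (1 <= m)%N -> (k <= T)%N ->
    0 <= \sum_(m <= t < k.+1) quad (C t) u.
  move=> m1 kT; rewrite big_nat_cond; apply: sumr_ge0 => t /andP[/andP[mt tk] _].
  by rewrite q_ge0// (leq_trans m1 mt) (leq_trans _ kT).
have q_le1 t : (1 <= t <= T)%N -> quad (C t) (y t) <= 1.
  by move=> /CP[_ [_ ?]]; exact: simplex_quad_le1.
have minloss0 : 0 <= minloss C r s.
  by apply: (minloss_ge y1s) => u _; exact: sum_ge0.
have bL0 : 0 <= b * L by rewrite mulr_ge0 ?ltW.
have [nE|n_neq1] := eqVneq n 1%N.
  suff : \sum_(r <= t < s.+1) quad (C t) (y t) <= minloss C r s by lra.
  apply: (minloss_ge y1s) => u us; rewrite le_eqVlt; apply/orP; left; apply/eqP.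
  apply: eq_bigr => t _; congr quad.
  exact: simplex_dim1.
have n1 : (1 < n)%N by rewrite ltn_neqAle eq_sym n_neq1.
have [TE|T_neq1] := eqVneq T 1%N.
  have sE : s = 1%N by apply/eqP; rewrite eqn_leq -{1}TE sT (leq_trans r1 rs).
  have rE : r = 1%N by apply/eqP; rewrite eqn_leq -{1}sE rs r1.
  have := q_le1 1%N T1; have := minloss0; rewrite rE sE big_nat1.
  (* The single loss is at most 1, and [M >= 1 - 1 / N >= 1 / 2] for [N = (1 + T) n >= 2]. *)
  have := @ln_ge_tangent R 0 _ N0; rewrite -/M expR0 add0r.
  have : ((1 + T)%:R * n%:R)^-1 <= 2^-1 :> R.
    by rewrite lef_pV2 ?posrE// -natrM ler_nat TE leq_pmulr.
  lra.
have T2 : (1 < T)%N by rewrite ltn_neqAle eq_sym T_neq1.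
set d := (n%:R - 1) / (n%:R * T%:R + 1) : R.
have d0 : 0 <= d by rewrite divr_ge0// ?subr_ge0 ?ler1n// addr_ge0 ?mulr_ge0.
have budget := ln_budget R n1 T2; rewrite -/M -/d in budget.
have Td0 : 0 <= (T%:R - 2) * d by rewrite mulr_ge0// subr_ge0 ler_nat.
set gain := eta - eta ^+ 2 / 4 - eta ^+ 2 / (4 * b).
have gain0 : 0 <= gain.
  rewrite [gain](_ : _ = b * (3 * b + 1) / (2 * b + 1) ^+ 2); last first.
    by rewrite /gain /eta /a; field; rewrite !gt_eqF//; lra.
  by rewrite divr_ge0 ?exprn_ge0 ?mulr_ge0//; lra.
have window m u : (1 < m <= s)%N -> simplex u ->
    gain * (\sum_(m <= t < s.+1) quad (C t) (y t))
    <= b * (\sum_(m <= t < s.+1) quad (C t) u) + M + (T%:R - 2) * d.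
  move=> /andP[m1 ms] us.
  have := @window_loss _ _ T C y1 eta alpha b CP y1s alpha_itv eta0 b0 m (s - m) u.
  rewrite subnKC// => /(_ m1 sT us); rewrite -/gain -/y.
  have -> : n%:R / alpha = (1 + T)%:R * n%:R :> R.
    by rewrite /alpha mul1r invrK mulrC add1n.
  rewrite -/M.
  have := ln_mixing_weight_ge R T n0; rewrite -/alpha -/d; set w := ln _ => wd.
  suff : - ((s - m)%:R * w) <= (T%:R - 2) * d by lra.
  rewrite -mulrN; apply: (@le_trans _ _ ((s - m)%:R * d)).
    by rewrite ler_wpM2l.
  (* From [m >= 2] and [s <= T], at most [T - 2] mixings occur inside the window. *)
  by rewrite ler_wpM2r// -natrB// ler_nat leq_sub.
(* [y1] may have zero entries, so a window starting at 1 pays its first round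
   at the maximal loss 1 and the entropy argument starts at round 2. *)
have total u : simplex u ->
    gain * (\sum_(r <= t < s.+1) quad (C t) (y t) - 1)
    <= b * (\sum_(r <= t < s.+1) quad (C t) u) + M + (T%:R - 2) * d.
  move=> us; have [r2|r_le1] := ltnP 1 r.
    have := window r u; rewrite r2 rs => /(_ isT us); lra.
  have rE : r = 1%N by apply/eqP; rewrite eqn_leq r_le1 r1.
  have q11 := q_le1 1%N T1.
  have C1u := q_ge0 1%N u T1.
  have s1 : (1 < s.+1)%N := leq_trans r1 rs.
  rewrite rE !(@big_ltn _ _ _ 1)//; set q1 := quad _ _ in q11 *.
  set u1 := quad _ _ in C1u *; set Q := \sum_(2 <= t < _) quad _ (y t).
  set S := \sum_(2 <= t < _) quad _ u.
  have bu1 : 0 <= b * u1 := mulr_ge0 (ltW b0) C1u.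
  have gq1 : gain * q1 <= gain * 1 := ler_wpM2l gain0 q11.
  suff : gain * Q <= b * S + M + (T%:R - 2) * d by lra.
  have [s2|s_le1] := ltnP 1 s; first by apply: window.
  rewrite /Q /S !big_geq// !mulr0 add0r addr_ge0//.
(* Solving [total] for the loss of [u] gives a bound free of [u], which therefore passes to the
   infimum. *)
have minE : (gain * (\sum_(r <= t < s.+1) quad (C t) (y t) - 1) - M
    - (T%:R - 2) * d) / b <= minloss C r s.
  by apply: (minloss_ge y1s) => u us; rewrite ler_pdivrMr//; have := total u us; lra.
rewrite ler_pdivrMr// in minE.
have := @regret_arith R b L M ((T%:R - 2) * d)
  (\sum_(r <= t < s.+1) quad (C t) (y t)) (minloss C r s) b0 Td0 b2L budget
  (minL r s r1 rs sT).
rewrite -/gain; lra.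
Qed.
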